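(* Let $N > 2$ and $M \geq 2$ be integers, and let $r \in \{1,\dots,M\}$. The following statements are equivalent: (i) $N$ is prime; (ii) for all $\vec{k} \in \mathcal{D}_M$: $\mathbf{1}_{\mathbb{Z}\setminus N\mathbb{Z}}(X^{N,r}_{\vec{k}})=0$; (iii) for all $\vec{k} \in \mathcal{D}_M$: $\left|\mathbf{1}_{\mathbb{Z}\setminus N\mathbb{Z}}(X^{N,r}_{\vec{k}})-\mathbf{1}_{\mathbb{Z}\setminus N\mathbb{Z}}(Y^{N,r}_{\vec{k}})\right|=1$. Moreover, if $N$ is prime, then for all $\vec{k} \in \mathcal{D}_M$: $\mathbf{1}_{\mathbb{Z}\setminus N\mathbb{Z}}(Y^{N,r}_{\vec{k}})=1$.
   Context: $\mathcal{D}_M$ (depending on $N$) is the set of integer vectors $\vec{k}=(k_1,\dots,k_M)$ with all $k_l\ge 0$ and $K:=\sum_{l=1}^M k_l$ satisfying $0\le K\le N-1$. The multinomial coefficient is $\binom{K}{\vec{k}}=\binom{K}{k_1,\dots,k_M}=\frac{K!}{\prod_{l=1}^M k_l!}$. For $\vec{k}\in\mathcal{D}_M$ and $r\in\{1,\dots,M\}$, define the multinomial coefficient $T^{N,r}_{\vec{k}}=\binom{N-1-k_r}{k_1,\dots,k_{r-1},\,N-1-K,\,k_{r+1},\dots,k_M}$ (the $r$-th lower entry $k_r$ is replaced by $N-1-K$), and $X^{N,r}_{\vec{k}}=\binom{K}{\vec{k}}-(-1)^{K+k_r}\,T^{N,r}_{\vec{k}}$, $Y^{N,r}_{\vec{k}}=\binom{K}{\vec{k}}+(-1)^{K+k_r}\,T^{N,r}_{\vec{k}}$.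 For an integer $x$, $\mathbf{1}_{\mathbb{Z}\setminus N\mathbb{Z}}(x)$ equals $0$ if $N$ divides $x$, and $1$ otherwise. *)

(* Defs.v *)
From mathcomp Require Import all_boot all_order all_algebra.

Set Implicit Arguments.
Unset Strict Implicit.
Unset Printing Implicit Defensive.

Import Order.TTheory GRing.Theory Num.Theory.

(* Integer vectors (k_1, ..., k_M) with nonnegative entries are encoded as
   functions k : 'I_M -> nat. *)

Definition vsum (M : nat) (k : 'I_M -> nat) : nat := (\sum_(l < M) k l)%N.

Definition Dset (N M : nat) (k : 'I_M -> nat) : Prop := (vsum k <= N - 1)%N.

(* Only used when n is the sum of the entries of k; the quotient is then
   exact, by multinomialK. *)
Definition multinomial (M n : nat) (k : 'I_M -> nat) : nat :=
  (n`! %/ \prod_(l < M) (k l)`!)%N.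

Lemma multinomialK (M : nat) (k : 'I_M -> nat) :
  (multinomial (vsum k) k * \prod_(l < M) (k l)`! = (vsum k)`!)%N.
Proof.
apply: divnK; rewrite /vsum.
apply: (big_ind2 (fun p s => (p %| s`!)%N)) => // p1 s1 p2 s2 d1 d2.
apply: dvdn_trans (dvdn_mul d1 d2) _.
by rewrite -(bin_fact (leq_addr s2 s1)) addKn dvdn_mull.
Qed.

Definition replace_entry (M : nat) (r : 'I_M) (x : nat) (k : 'I_M -> nat) :
    'I_M -> nat :=
  fun l => if l == r then x else k l.

(* The subtractions below are on nat, hence truncated; they agree with those
   on the integers for k in Dset N M. *)
Definition Tcoef (N M : nat) (r : 'I_M) (k : 'I_M -> nat) : nat :=
  multinomial (N - 1 - k r)%N (replace_entry r (N - 1 - vsum k)%N k).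

Lemma Tcoef_sum (N M : nat) (r : 'I_M) (k : 'I_M -> nat) : Dset N k ->
  vsum (replace_entry r (N - 1 - vsum k)%N k) = (N - 1 - k r)%N.
Proof.
rewrite /Dset /vsum => kD; rewrite (bigD1 r) //= {1}/replace_entry eqxx.
have -> : (\sum_(l < M | l != r) replace_entry r (N - 1 - \sum_(l < M) k l) k l
           = \sum_(l < M | l != r) k l)%N.
  by apply: eq_bigr => l /negPf; rewrite /replace_entry => ->.
move: kD; rewrite (bigD1 r) //= => kD.
rewrite subnDA subnK // leq_subRL // (leq_trans (leq_addr _ _) kD) //.
Qed.

Local Open Scope ring_scope.

Definition Xcoef (N M : nat) (r : 'I_M) (k : 'I_M -> nat) : int :=
  (multinomial (vsum k) k)%:Z - (-1) ^+ (vsum k + k r)%N * (Tcoef N r k)%:Z.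

Definition Ycoef (N M : nat) (r : 'I_M) (k : 'I_M -> nat) : int :=
  (multinomial (vsum k) k)%:Z + (-1) ^+ (vsum k + k r)%N * (Tcoef N r k)%:Z.

Definition ind_nmul (N : nat) (x : int) : int :=
  if (N%:Z %| x)%Z then 0 else 1.

(* Main.v *)
Require Import Defs.
From mathcomp Require Import all_boot all_order all_algebra.
From mathcomp Require Import zify ring.

(** The entry [k_r] splits off both multinomial coefficients: writing
    [a = k_r], [S] for the sum of the other entries and [Q] for the
    multinomial coefficient of the other entries,
      [C = 'C(a + S, S) * Q]  and  [T = 'C(N - 1 - a, S) * Q],
    and the sign is [(-1)^S] (lemmas [multinomial_bin] and [Tcoef_bin]).

    If [N] is prime, everything follows from upper negation modulo [N]: the
    factors of the falling factorial [(N - 1 - a) ... (N - a - S)] are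
    congruent to [-(a + 1), ..., -(a + S)], so that
    [S`! * ('C(a + S, S) - (-1)^S * 'C(N - 1 - a, S))] is divisible by [N]
    ([upper_negation_mod]), and [S`!] is invertible modulo [N].  Hence [N]
    divides [X], and [X + Y = 2 * C] is prime to [N] because [C] divides
    [K`!], so [N] does not divide [Y].

    Conversely, vectors with two nonzero entries, [a] at [r] and [b]
    elsewhere, have [Q = 1].  Taking [a = 0], either of the conditions (ii) and
    (iii) forces ['C(N - 1, b)] to be 1 or -1 modulo [N] for every [b < N].
    Comparing [b = p - 1] and [b = p] for the least prime factor [p] of [N]
    leaves only [N] prime or [N = 4] ([bin_pm1_mod]).  Indeed, the third row
    1, 3, 3, 1 of Pascal's triangle is 1 or -1 modulo 4 throughout, so 4 is a
    genuine exception at this stage; it is excluded by the pair [(0, 2)] for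
    (ii), and by [(1, 1)] for (iii), where [X = 4] and [Y = 0]. *)

Set Implicit Arguments.
Unset Strict Implicit.
Unset Printing Implicit Defensive.

Import Order.TTheory GRing.Theory Num.Theory.
Local Open Scope ring_scope.

(** * Splitting one entry off a multinomial coefficient *)

Definition rest (M : nat) (r : 'I_M) (k : 'I_M -> nat) : nat :=
  (\sum_(l < M | l != r) k l)%N.

Lemma vsumD1 (M : nat) (r : 'I_M) (k : 'I_M -> nat) :
  vsum k = (k r + rest r k)%N.
Proof. by rewrite /vsum (bigD1 r). Qed.

Lemma rest_replace (M : nat) (r : 'I_M) (x : nat) (k : 'I_M -> nat) :
  rest r (replace_entry r x k) = rest r k.
Proof.
by apply: eq_bigr => l /negPf; rewrite /replace_entry => ->.
Qed.

Lemma replace_entry_id (M : nat) (r : 'I_M) (x : nat) (k : 'I_M -> nat) :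
  replace_entry r x k r = x.
Proof. by rewrite /replace_entry eqxx. Qed.

Lemma vsum_replace (M : nat) (r : 'I_M) (x : nat) (k : 'I_M -> nat) :
  vsum (replace_entry r x k) = (x + rest r k)%N.
Proof. by rewrite (vsumD1 r) rest_replace replace_entry_id. Qed.

(** Setting [k_r] to 0 stands for deleting it, since [0`! = 1]. *)
Definition rest_multinomial (M : nat) (r : 'I_M) (k : 'I_M -> nat) : nat :=
  multinomial (rest r k) (replace_entry r 0 k).

Lemma rest_multinomial_replace (M : nat) (r : 'I_M) (x : nat)
    (k : 'I_M -> nat) :
  rest_multinomial r (replace_entry r x k) = rest_multinomial r k.
Proof.
rewrite /rest_multinomial rest_replace /multinomial; congr (_ %/ _)%N.
by apply: eq_bigr => l _; rewrite /replace_entry; case: (l == r).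
Qed.

Lemma multinomial_bin (M : nat) (r : 'I_M) (k : 'I_M -> nat) :
  multinomial (vsum k) k = ('C(vsum k, rest r k) * rest_multinomial r k)%N.
Proof.
have prod_gt0 : (0 < \prod_(l < M) (k l)`!)%N.
  by apply: prodn_gt0 => l; apply: fact_gt0.
apply/eqP; rewrite -(eqn_pmul2r prod_gt0) multinomialK.
have := multinomialK (replace_entry r 0 k); rewrite vsum_replace add0n.
rewrite -/(rest_multinomial r k) (bigD1 r) //= replace_entry_id fact0 mul1n.
under eq_bigr => l lr do rewrite /replace_entry (negPf lr).
have -> : (\prod_(l < M) (k l)`! =
           (k r)`! * \prod_(l < M | l != r) (k l)`!)%N by rewrite (bigD1 r).
set P := (\prod_(l < M | _) _)%N => restK.
have <- : ('C(vsum k, rest r k) * ((rest r k)`! * (k r)`!) = (vsum k)`!)%N.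
  by rewrite (vsumD1 r) -(bin_fact (leq_addl (k r) (rest r k))) addnK.
by rewrite -restK; apply/eqP; ring.
Qed.

Lemma Tcoef_bin (N M : nat) (r : 'I_M) (k : 'I_M -> nat) : Dset N k ->
  Tcoef N r k = ('C(N - 1 - k r, rest r k) * rest_multinomial r k)%N.
Proof.
move=> kD; rewrite /Tcoef -(Tcoef_sum r kD) (multinomial_bin r).
by rewrite rest_replace rest_multinomial_replace.
Qed.

Lemma sign_vsum (M : nat) (r : 'I_M) (k : 'I_M -> nat) :
  (-1) ^+ (vsum k + k r)%N = (-1) ^+ rest r k :> int.
Proof.
by rewrite (vsumD1 r) addnAC addnn exprD -signr_odd odd_double mul1r.
Qed.

Lemma Xcoef_bin (N M : nat) (r : 'I_M) (k : 'I_M -> nat) : Dset N k ->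
  Xcoef N r k = (rest_multinomial r k)%:Z * ('C(k r + rest r k, rest r k)%:Z
    - (-1) ^+ rest r k * 'C(N - 1 - k r, rest r k)%:Z).
Proof.
move=> kD; rewrite /Xcoef sign_vsum Tcoef_bin // (multinomial_bin r).
by rewrite -vsumD1 !PoszM; ring.
Qed.

Lemma XcoefDYcoef (N M : nat) (r : 'I_M) (k : 'I_M -> nat) :
  Xcoef N r k + Ycoef N r k = 2 * (multinomial (vsum k) k)%:Z.
Proof. by rewrite /Xcoef /Ycoef; ring. Qed.

(** * The prime case *)

(** Both falling factorials have [S] factors, and the factor [N - 1 - a - i] of
    the second is congruent to minus the factor [a + 1 + i] of the first. *)
Lemma upper_negation_mod (N a S : nat) : (a + S < N)%N ->
  (N%:Z %| S`!%:Z * ('C(a + S, S)%:Z - (-1) ^+ S * 'C(N - 1 - a, S)%:Z))%Z.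
Proof.
move=> ltN; rewrite mulrBr mulrCA -!PoszM ![(S`! * _)%N]mulnC !bin_ffact.
elim: S ltN => [|S IHS] ltN; first by rewrite !ffactn0 expr0 mul1r subrr.
rewrite addnS ffactSS ffactnSr.
rewrite !PoszM exprS (_ : (N - 1 - a - S)%N%:Z = N%:Z - (a + S).+1%:Z); last lia.
set A := ((a + S) ^_ S)%:Z; set B := ((N - 1 - a) ^_ S)%:Z.
rewrite (_ : _ - _ = (a + S).+1%:Z * (A - (-1) ^+ S * B)
                     + (-1) ^+ S * B * N%:Z); last ring.
by rewrite rpredD ?dvdz_mull // IHS // ltnW // -addnS.
Qed.

Lemma prime_coprime_fact (p n : nat) : prime p -> (n < p)%N -> coprime p n`!.
Proof.
move=> p_pr; elim: n => [|n IHn] ltnp; first by rewrite coprimen1.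
by rewrite factS coprimeMr IHn 1?ltnW // prime_coprime // gtnNdvd.
Qed.

Lemma prime_dvd_Xcoef (N M : nat) (r : 'I_M) (k : 'I_M -> nat) :
  prime N -> Dset N k -> (N%:Z %| Xcoef N r k)%Z.
Proof.
move=> N_pr kD; rewrite Xcoef_bin // dvdz_mull //.
have ltN : (k r + rest r k < N)%N.
  by rewrite -vsumD1; move: kD (prime_gt0 N_pr); rewrite /Dset; lia.
rewrite -(@Gauss_dvdzr _ (rest r k)`!%:Z) ?upper_negation_mod //.
by rewrite coprimezE prime_coprime_fact // (leq_ltn_trans (leq_addl _ _) ltN).
Qed.

Lemma prime_ndvd_Ycoef (N M : nat) (r : 'I_M) (k : 'I_M -> nat) :
  (2 < N)%N -> prime N -> Dset N k -> ~~ (N%:Z %| Ycoef N r k)%Z.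
Proof.
move=> N_gt2 N_pr kD; rewrite -(rpredDl _ (prime_dvd_Xcoef r N_pr kD)).
rewrite XcoefDYcoef -PoszM dvdzE /= -prime_coprime // coprimeMr.
rewrite prime_coprime // gtnNdvd //=.
have: coprime N (vsum k)`!.
  by apply: prime_coprime_fact => //; move: kD; rewrite /Dset; lia.
by rewrite -multinomialK coprimeMr => /andP[].
Qed.

(** * Vectors with two nonzero entries *)

Definition two_entries (M : nat) (r s : 'I_M) (a b : nat) : 'I_M -> nat :=
  replace_entry r a (replace_entry s b (fun=> 0%N)).

Lemma rest_two_entries (M : nat) (r s : 'I_M) (a b : nat) : s != r ->
  rest r (two_entries r s a b) = b.
Proof.
move=> sr; rewrite /two_entries rest_replace /rest (bigD1 s) //=.
rewrite replace_entry_id big1 ?addn0 // => l /andP[_ /negPf ls].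
by rewrite /replace_entry ls.
Qed.

Lemma vsum_two_entries (M : nat) (r s : 'I_M) (a b : nat) : s != r ->
  vsum (two_entries r s a b) = (a + b)%N.
Proof.
by move=> sr; rewrite (vsumD1 r) rest_two_entries // /two_entries replace_entry_id.
Qed.

Lemma rest_multinomial_two_entries (M : nat) (r s : 'I_M) (a b : nat) :
  s != r -> rest_multinomial r (two_entries r s a b) = 1%N.
Proof.
move=> sr; rewrite /rest_multinomial rest_two_entries // /multinomial.
rewrite (bigD1 s) //= big1 => [|l ls].
  by rewrite /two_entries /replace_entry (negPf sr) eqxx muln1 divnn fact_gt0.
by rewrite /two_entries /replace_entry (negPf ls); case: (l == r).
Qed.

Lemma Xcoef_two_entries (N M : nat) (r s : 'I_M) (a b : nat) :
  s != r -> (a + b <= N - 1)%N ->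
  Xcoef N r (two_entries r s a b) =
    'C(a + b, b)%:Z - (-1) ^+ b * 'C(N - 1 - a, b)%:Z.
Proof.
move=> sr leN; rewrite Xcoef_bin ?/Dset ?vsum_two_entries //.
rewrite rest_multinomial_two_entries // rest_two_entries // mul1r.
by rewrite /two_entries replace_entry_id.
Qed.

Lemma Ycoef_two_entries (N M : nat) (r s : 'I_M) (a b : nat) :
  s != r -> (a + b <= N - 1)%N ->
  Ycoef N r (two_entries r s a b) =
    'C(a + b, b)%:Z + (-1) ^+ b * 'C(N - 1 - a, b)%:Z.
Proof.
move=> sr leN; have kD : Dset N (two_entries r s a b).
  by rewrite /Dset vsum_two_entries.
rewrite /Ycoef sign_vsum Tcoef_bin // (multinomial_bin r).
rewrite rest_multinomial_two_entries // rest_two_entries // vsum_two_entries //.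
by rewrite !muln1 /two_entries replace_entry_id.
Qed.

(** * The converse *)

(** Write [N = m * p] with [p] the least prime factor.  The identity
    [p * 'C(N, p) = N * 'C(N - 1, p - 1)] gives
    ['C(N - 1, p - 1) + 'C(N - 1, p) = m * 'C(N - 1, p - 1)].  The left side is
    0, 2 or -2 modulo [N].  In the first case [N] would divide [m], because
    ['C(N - 1, p - 1)] is 1 or -1 modulo [N]; otherwise [m], which divides [N],
    divides 2, and [m = 2] forces [p = 2]. *)
Lemma bin_pm1_mod (N : nat) : (2 < N)%N ->
  (forall b, (b <= N - 1)%N ->
     (N%:Z %| 1 - 'C(N - 1, b)%:Z)%Z || (N%:Z %| 1 + 'C(N - 1, b)%:Z)%Z) ->
  prime N \/ N = 4.
Proof.
move=> N_gt2 pm1.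
have p_pr : prime (pdiv N) by apply: pdiv_prime; lia.
have [m Nmp] : exists m, N = (m * pdiv N)%N.
  by exists (N %/ pdiv N)%N; rewrite divnK // pdiv_dvd.
have le_pm : (1 < m)%N -> (pdiv N <= m)%N.
  by move=> m_gt1; apply: pdiv_min_dvd => //; rewrite Nmp dvdn_mulr.
case: (pdiv N) p_pr Nmp le_pm => [//|q] p_pr Nmp le_pm.
have q_gt0 : (0 < q)%N by have := prime_gt1 p_pr.
have m_gt0 : (0 < m)%N by case: (m) Nmp => //; lia.
have [m1|m_neq1] := eqVneq m 1%N; first by left; rewrite Nmp m1 mul1n.
have qN : (q.+1 <= N - 1)%N by nia.
have binD : ('C(N - 1, q) + 'C(N - 1, q.+1) = m * 'C(N - 1, q))%N.
  rewrite addnC -binS subn1 prednK; last lia.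
  apply/eqP; rewrite -(@eqn_pmul2l q.+1) //; apply/eqP.
  by rewrite -mul_bin_diag mulnA [(q.+1 * m)%N]mulnC -Nmp.
have dvdmz z : (N%:Z %| z)%Z -> (m%:Z %| z)%Z.
  by apply: dvdz_trans; rewrite Nmp PoszM dvdz_mulr.
have m_dvd2 : (N%:Z %| m%:Z * 'C(N - 1, q)%:Z - 2)%Z
    || (N%:Z %| m%:Z * 'C(N - 1, q)%:Z + 2)%Z -> N = 4.
  move=> dvdN; have: (m %| 2)%N.
    rewrite -[(m %| 2)%N]/(m%:Z %| 2)%Z.
    case/orP: dvdN => /dvdmz; last by rewrite rpredDl ?dvdz_mulr.
    by rewrite rpredBl ?dvdz_mulr.
  move/dvdn_leq => /(_ isT) m_le2; have m2 : m = 2 by lia.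
  by have := le_pm; nia.
have Nndvdm : (N%:Z %| m%:Z)%Z -> N = 4.
  by rewrite dvdzE /= => /dvdn_leq; nia.
right; have qN' : (q <= N - 1)%N by apply: ltnW.
move: binD m_dvd2 (pm1 _ qN') (pm1 _ qN).
set b := 'C(N - 1, q)%:Z; set c := 'C(N - 1, q.+1)%:Z => binD m_dvd2.
have {}binD : m%:Z * b = b + c by rewrite /b /c; lia.
case/orP=> dvdb; case/orP=> dvdc.
- apply: m_dvd2; rewrite binD (_ : _ - 2 = - (1 - b) - (1 - c)); last ring.
  by rewrite rpredB ?rpredN.
- apply: Nndvdm; rewrite (_ : m%:Z = m%:Z * (1 - b) + (1 + c) - (1 - b)).
    exact: rpredB (rpredD (dvdz_mull _ dvdb) dvdc) dvdb.
  by rewrite mulrBr binD; ring.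
- apply: Nndvdm; rewrite (_ : m%:Z = m%:Z * (1 + b) + (1 - c) - (1 + b)).
    exact: rpredB (rpredD (dvdz_mull _ dvdb) dvdc) dvdb.
  by rewrite mulrDr binD; ring.
- apply: m_dvd2; apply/orP; right.
  rewrite binD (_ : b + c + 2 = (1 + b) + (1 + c)); last ring.
  exact: rpredD.
Qed.

Lemma ind_nmul_eq0 (N : nat) (x : int) :
  (ind_nmul N x == 0) = (N%:Z %| x)%Z.
Proof. by rewrite /ind_nmul; case: ifP. Qed.

Lemma ind_nmul_dist (N : nat) (x y : int) :
  (`|ind_nmul N x - ind_nmul N y| == 1) = ((N%:Z %| x)%Z (+) (N%:Z %| y)%Z).
Proof. by rewrite /ind_nmul; do 2 case: ifP. Qed.

Theorem theorem4p10 (N M : nat) (r : 'I_M) (hN : (2 < N)%N) (hM : (2 <= M)%N) :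
  (prime N <->
     (forall k : 'I_M -> nat, Dset N k -> ind_nmul N (Xcoef N r k) = 0))
  /\ (prime N <->
     (forall k : 'I_M -> nat, Dset N k ->
        `|ind_nmul N (Xcoef N r k) - ind_nmul N (Ycoef N r k)| = 1))
  /\ (prime N ->
      forall k : 'I_M -> nat, Dset N k -> ind_nmul N (Ycoef N r k) = 1).
Proof.
have [s sr] : exists s : 'I_M, s != r.
  have [r0|r0] := posnP r.
    by exists (Ordinal hM); rewrite -val_eqE /= r0.
  by exists (Ordinal (ltnW hM)); rewrite -val_eqE /= eq_sym -lt0n.
have small b : (b <= N - 1)%N ->
    (N%:Z %| Xcoef N r (two_entries r s 0 b))%Z
    || (N%:Z %| Ycoef N r (two_entries r s 0 b))%Z ->
    (N%:Z %| 1 - 'C(N - 1, b)%:Z)%Z || (N%:Z %| 1 + 'C(N - 1, b)%:Z)%Z.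
  move=> bN; rewrite Xcoef_two_entries // Ycoef_two_entries // add0n subn0 binn.
  rewrite -signr_odd; case: odd; last by rewrite expr0 mul1r.
  by rewrite expr1 mulN1r opprK orbC.
have Dtwo a b : (a + b <= N - 1)%N -> Dset N (two_entries r s a b).
  by move=> abN; rewrite /Dset vsum_two_entries.
split; [split=> [N_pr k kD|dvdX]|split; [split=> [N_pr k kD|dist1]|]].
- by apply/eqP; rewrite ind_nmul_eq0 prime_dvd_Xcoef.
- have [b bN|//|N4] := bin_pm1_mod hN.
    by apply: small => //; rewrite -ind_nmul_eq0 dvdX ?eqxx //; apply: Dtwo.
  move: Dtwo dvdX; rewrite N4 => Dtwo dvdX.
  move/eqP: (dvdX _ (Dtwo 0%N 2%N isT)).
  by rewrite ind_nmul_eq0 Xcoef_two_entries.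
- apply/eqP; rewrite ind_nmul_dist prime_dvd_Xcoef //=.
  exact: prime_ndvd_Ycoef.
- have [b bN|//|N4] := bin_pm1_mod hN.
    apply: small => //; move/eqP: (dist1 _ (Dtwo 0%N b bN)).
    by rewrite ind_nmul_dist; do 2 case: (_ %| _)%Z.
  move: Dtwo dist1; rewrite N4 => Dtwo dist1.
  move/eqP: (dist1 _ (Dtwo 1%N 1%N isT)).
  by rewrite ind_nmul_dist Xcoef_two_entries // Ycoef_two_entries.
- move=> N_pr k kD; rewrite /ind_nmul.
  by rewrite (negPf (prime_ndvd_Ycoef r hN N_pr kD)).
Qed.
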